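(* For all integers $v\ge 3$ and $\delta$ with $1\le\delta\le v-2$, and every integer $n\ge v$, $$\mathrm{wsat}(n,F_{v,\delta})=\binom{v-1}{2}+(n-v+1)(\delta-1),$$ where $F_{v,\delta}$ is the graph obtained from the complete graph $K_v$ by removing $v-1-\delta$ edges incident to one and the same vertex.
   Context: All graphs are finite and simple. Given a graph $F$, an $F$-bootstrap percolation process is a sequence of graphs $H_0\subset H_1\subset\cdots\subset H_m$ on the same vertex set such that, for each $i=1,\ldots,m$, $H_i$ is obtained from $H_{i-1}$ by adding one edge that belongs to a copy of $F$ (a not necessarily induced subgraph isomorphic to $F$) in $H_i$. A graph $H$ on $[n]=\{1,\ldots,n\}$ is weakly $F$-saturated if there is an $F$-bootstrap percolation process $H=H_0\subset\cdots\subset H_m=K_n$. The number $\mathrm{wsat}(n,F)$ is the minimum number of edges of a weakly $F$-saturated graph on $[n]$. *)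

(* Defs.v *)
From HB Require Import structures.
From mathcomp Require Import all_boot.

Set Implicit Arguments.
Unset Strict Implicit.
Unset Printing Implicit Defensive.

(* A simple graph with vertex set T, given by its edge set: a set of
   two-element subsets of T. *)
Record sgraph (T : finType) := SGraph {
  edges :> {set {set T}};
  edges_card2 : [forall e in edges, #|e| == 2]
}.

HB.instance Definition _ (T : finType) := [isSub for @edges T].
HB.instance Definition _ (T : finType) := [Finite of sgraph T by <:].

Lemma complete_card2 (T : finType) :
  [forall e in [set e : {set T} | #|e| == 2], #|e| == 2].
Proof. by apply/forall_inP => e; rewrite inE. Qed.

Definition complete_graph (T : finType) : sgraph T :=
  SGraph (complete_card2 T).

Lemma delete_edges_card2 (T : finType) (G : sgraph T) (R : {set {set T}}) :
  [forall e in edges G :\: R, #|e| == 2].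
Proof.
apply/forall_inP => e /setDP[eG _].
by have /forall_inP := edges_card2 G; apply.
Qed.

Definition delete_edges (T : finType) (G : sgraph T) (R : {set {set T}}) :
  sgraph T := SGraph (delete_edges_card2 G R).

(* Copies are not necessarily induced: the copy given by an injective f has
   vertex set f(V) and edges f(a), a an edge of F. *)
Definition is_copy (V T : finType) (F : sgraph V) (H : sgraph T)
    (f : {ffun V -> T}) : bool :=
  injectiveb f && [forall a in edges F, f @: a \in edges H].

Definition in_copy (V T : finType) (F : sgraph V) (H : sgraph T)
    (e : {set T}) : bool :=
  [exists f : {ffun V -> T},
     is_copy F H f && [exists a in edges F, e == f @: a]].

Definition bootstrap_step (V T : finType) (F : sgraph V) : rel (sgraph T) :=
  fun H H' => [exists e : {set T},
    [&& e \notin edges H, edges H' == e |: edges H & in_copy F H' e]].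

(* The process H_0, ..., H_m with H_0 = H and s = [:: H_1; ...; H_m]. *)
Definition bootstrap_process (V T : finType) (F : sgraph V)
    (H : sgraph T) (s : seq (sgraph T)) : bool :=
  path (bootstrap_step F) H s.

(* Boolean form of the existence of a process from H to the complete graph;
   see weakly_saturatedP. *)
Definition weakly_saturated (V T : finType) (F : sgraph V) (H : sgraph T) :
  bool := connect (bootstrap_step F) H (complete_graph T).

Lemma weakly_saturatedP (V T : finType) (F : sgraph V) (H : sgraph T) :
  reflect (exists2 s, bootstrap_process F H s & last H s = complete_graph T)
          (weakly_saturated F H).
Proof.
by apply: (iffP connectP) => -[s Hs Es]; exists s.
Qed.

Lemma weakly_saturated_complete (V T : finType) (F : sgraph V) :
  weakly_saturated F (complete_graph T).
Proof. exact: connect0. Qed.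

(* The minimum is over a nonempty set, by weakly_saturated_complete. *)
Definition wsat (n : nat) (V : finType) (F : sgraph V) : nat :=
  #|edges [arg min_(H < complete_graph 'I_n | weakly_saturated F H)
             #|edges H|]|.

Lemma wsatP (n : nat) (V : finType) (F : sgraph V) (k : nat) :
  wsat n F = k <->
  (exists2 H : sgraph 'I_n, weakly_saturated F H & #|edges H| = k) /\
  (forall H : sgraph 'I_n, weakly_saturated F H -> k <= #|edges H|).
Proof.
rewrite /wsat; case: arg_minnP => [|H Hw Hmin].
  exact: weakly_saturated_complete.
split=> [<-|[[G Gw <-] Gmin]]; first by split; [exists H | exact: Hmin].
by apply/eqP; rewrite eqn_leq Hmin // Gmin.
Qed.

(* The vertex 0 plays the role of the distinguished vertex; it loses its
   edges to d + 1, ..., v - 1, so that its neighbours are 1, ..., d. *)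
Definition removed_edges (v d : nat) : {set {set 'I_v}} :=
  [set [set x; y] | x in [set x : 'I_v | x == 0 :> nat],
                    y in [set y : 'I_v | d < y]].

Definition F_graph (v d : nat) : sgraph 'I_v :=
  delete_edges (complete_graph 'I_v) (removed_edges v d).

Lemma removed_edges_sub (v d : nat) :
  removed_edges v d \subset edges (complete_graph 'I_v).
Proof.
apply/subsetP=> e /imset2P[x y]; rewrite !inE => /eqP x0 dy ->.
rewrite cards2; suff -> : x != y by [].
by apply: contraTneq dy => <-; rewrite x0.
Qed.

Lemma card_removed_edges (v d : nat) : #|removed_edges v d| = v - 1 - d.
Proof.
case: v => [|v].
  by apply: eq_card0 => e; apply/negP => /imset2P[[]].
have -> : removed_edges v.+1 d =
    [set [set ord0; y] | y in [set y : 'I_v.+1 | d < y]].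
  apply/setP=> e; apply/imset2P/imsetP => [[x y]|[y]].
    rewrite !inE => /eqP x0 dy ->; exists y; rewrite ?inE //.
    by have -> : x = ord0 by apply/val_inj.
  by rewrite inE => dy ->; exists ord0 y; rewrite ?inE.
rewrite card_in_imset => [|y z]; last first.
  rewrite !inE => dy _ /setP/(_ y); rewrite !inE eqxx orbT => /esym.
  by case/orP=> /eqP // y0; rewrite y0 in dy.
rewrite cardsE cardE size_filter -(count_map val (ltn d)) -enumT val_enum_ord.
have -> : v.+1 - 1 = v by rewrite subn1.
elim: v => [|v IH]; first by case: d.
rewrite -[v.+2]addn1 iotaD count_cat IH /= add0n addn0 addnC.
have [dv|vd] := leqP d v; first by rewrite ltnS dv subSn.
have /eqP -> : v.+1 - d == 0 by rewrite subn_eq0.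
have /eqP -> : v - d == 0 by rewrite subn_eq0 ltnW.
by rewrite ltnS leqNgt vd.
Qed.

(* Main.v *)
(* Lower bound: every edge of F = F_(v,d) lies in a copy of K_(d+1) inside F,
   so a process for F is in particular one for K_(d+1).  Moreover the graph H_1
   after the first step contains a whole copy of F, in which C(v-d,2) + 1 edges
   are redundant for the K_(d+1)-process; hence |H| + 1 exceeds the
   K_(d+1)-saturation number C(n,2) - C(n-d+1,2) by at least C(v-d,2) + 1.
   The bound for K_(d+1) is the skew set-pair argument in polynomial form: a
   clique C yields the function {x, y} |-> prod_(z notin C) (z - x)(z - y),
   which vanishes exactly on the pairs not contained in C and is a polynomial
   of degree at most n - d - 1 in x + y and xy.

   Upper bound: K_(v-1) with every outside vertex joined to the same d - 1
   vertices of it. *)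

Require Import Defs.
From mathcomp Require Import all_boot all_algebra zify ring.

Set Implicit Arguments.
Unset Strict Implicit.
Unset Printing Implicit Defensive.

(** * Sets of pairs and the clique bootstrap process *)

Definition pairs (T : finType) (A : {set T}) : {set {set T}} :=
  [set e : {set T} | e \subset A & #|e| == 2].

Lemma card_pairs (T : finType) (A : {set T}) : #|pairs A| = 'C(#|A|, 2).
Proof. exact: cards_draws. Qed.

Lemma ex_subset_between (T : finType) (A B : {set T}) m :
  A \subset B -> #|A| <= m <= #|B| ->
  exists2 C : {set T}, A \subset C /\ C \subset B & #|C| = m.
Proof.
move=> sAB /andP[leAm lemB].
have [k Ek] : exists k, m = #|A| + k by exists (m - #|A|); rewrite subnKC.
elim: k => [|k IHk] in m leAm lemB Ek *; first by exists A; rewrite ?Ek ?addn0.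
have [||//|C [sAC sCB] cC] := IHk (#|A| + k); first exact: leq_addr.
  by lia.
have /properP[_ [x Bx nCx]] : C \proper B by rewrite properEcard sCB cC; lia.
exists (x |: C); last by rewrite cardsU1 nCx cC; lia.
by split; rewrite ?subUset ?sub1set ?Bx // (subset_trans sAC) ?subsetUr.
Qed.

Lemma card_ord_lt n m : m <= n -> #|[set x : 'I_n | x < m]| = m.
Proof.
move=> lemn.
have -> : [set x : 'I_n | x < m] = widen_ord lemn @: setT.
  apply/setP=> x; rewrite inE; apply/idP/imsetP => [ltxm|[y _ ->]].
    by exists (Ordinal ltxm) => //; apply: val_inj.
  exact: (ltn_ord y).
by rewrite card_imset ?cardsT ?card_ord // => x y /(congr1 val)/= /val_inj.
Qed.

(** The added pair may already be present, so translating a process or adding a batch of pairs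
    requires no freshness condition. *)
Inductive clique_reach (T : finType) (m : nat) (E : {set {set T}}) :
    {set {set T}} -> Prop :=
| clique_reach_refl : clique_reach m E E
| clique_reach_add E' e (C : {set T}) : clique_reach m E E' ->
    #|C| = m -> e \in pairs C -> pairs C \subset e |: E' ->
    clique_reach m E (e |: E').

(** Each pair of [R] is completed by [E'] alone, so enlarging [E'] does no harm and any order of
    addition works. *)
Lemma clique_reach_addU (T : finType) m (E E' R : {set {set T}}) :
  clique_reach m E E' ->
  (forall e, e \in R -> exists C : {set T},
     [/\ #|C| = m, e \in pairs C & pairs C \subset e |: E']) ->
  clique_reach m E (R :|: E').
Proof.
move=> EE' RP; rewrite -[R]set_enum.
have : {subset enum R <= R} by move=> e; rewrite mem_enum.
elim: (enum R) => [_|e r IHr sub].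
  by rewrite (_ : [set _ in _] = set0) ?set0U //; apply/setP=> x; rewrite !inE.
have -> : [set x in e :: r] = e |: [set x in r].
  by apply/setP=> x; rewrite !inE.
have [C [cC eC sC]] := RP e (sub _ (mem_head _ _)).
rewrite -setUA; apply: (clique_reach_add (C := C)) => //.
  by apply: IHr => x xr; apply: sub; rewrite inE xr orbT.
by apply: subset_trans sC _; rewrite setUS ?subsetUr.
Qed.

(** * Lower bound for clique saturation by polynomial functions on pairs *)

Section EdgeFunctions.

Import GRing.Theory.
Local Open Scope ring_scope.

Variable n : nat.

Definition edge_fun := {ffun {set 'I_n} -> rat^o}.

Definition esum (e : {set 'I_n}) : rat := \sum_(x in e) (x : nat)%:R.
Definition eprod (e : {set 'I_n}) : rat := \prod_(x in e) (x : nat)%:R.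

Definition emonom i j : edge_fun := [ffun e => esum e ^+ i * eprod e ^+ j].

(* The polynomials of degree at most b in x + y and xy, as functions of {x, y}. *)
Definition edge_polys b : {vspace edge_fun} :=
  <<[seq emonom (k - j) j | k <- iota 0 b.+1, j <- iota 0 k.+1]>>%VS.

(** There are k + 1 monomials of each degree k from 0 to b, and 1 + ... + (b + 1) = C(b + 2, 2). *)
Lemma dim_edge_polys b : (\dim (edge_polys b) <= 'C(b.+2, 2))%N.
Proof.
apply: leq_trans (dim_span _) _; rewrite size_allpairs_dep -bin2_sum.
rewrite big_nat_recl // add0n sumnE big_map /index_iota subn0.
by under eq_bigr do rewrite size_iota.
Qed.

Lemma emonom_in b i j : (i + j <= b)%N -> emonom i j \in edge_polys b.
Proof.
move=> leb; apply/memv_span/allpairsPdep; exists (i + j)%N, j.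
by rewrite !mem_iota addnK !add0n !ltnS leq_addl.
Qed.

(** On a pair this is (z - x)(z - y), kept in expanded form to show that it has degree one in [esum]
    and [eprod]. *)
Definition eval_at z e : rat := z ^+ 2 - esum e * z + eprod e.

Lemma eval_at_pair z (x y : 'I_n) : x != y ->
  eval_at z [set x; y] = (z - (x : nat)%:R) * (z - (y : nat)%:R).
Proof.
move=> nxy; rewrite /eval_at /esum /eprod !big_setU1 ?inE //= !big_set1.
by ring.
Qed.

Lemma eval_at_eq0 (z : 'I_n) (e : {set 'I_n}) : #|e| = 2 ->
  (eval_at (z : nat)%:R e == 0) = (z \in e).
Proof.
move=> /eqP/cards2P[x [y [nxy ->]]].
by rewrite eval_at_pair // mulf_eq0 !subr_eq0 !Num.Theory.eqr_nat !inE.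
Qed.

(** Each factor raises the degree by at most one; the exponents [i] and [j] are carried along so
    that the induction can absorb the monomials of the factor split off. *)
Lemma prod_eval_in (s : seq 'I_n) b i j : (size s + i + j <= b)%N ->
  ([ffun e => esum e ^+ i * eprod e ^+ j *
     \prod_(z <- s) eval_at (z : nat)%:R e] : edge_fun) \in edge_polys b.
Proof.
elim: s i j => [|z s IHs] i j /= leb.
  rewrite (_ : [ffun _ => _] = emonom i j) ?emonom_in //.
  by apply/ffunP=> e; rewrite !ffunE big_nil mulr1.
set g := fun i j => [ffun e => esum e ^+ i * eprod e ^+ j *
     \prod_(z <- s) eval_at (z : nat)%:R e] : edge_fun.
rewrite (_ : [ffun _ => _] = ((z : nat)%:R ^+ 2) *: g i j
    - ((z : nat)%:R : rat) *: g i.+1 j + g i j.+1).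
  by rewrite rpredD ?rpredB ?rpredZ //; apply: IHs; lia.
apply/ffunP=> e; rewrite !ffunE big_cons /eval_at /GRing.scale /= !exprS.
by ring.
Qed.

Definition clique_fun (C : {set 'I_n}) : edge_fun :=
  [ffun e => \prod_(z <- enum (~: C)) eval_at (z : nat)%:R e].

Lemma clique_fun_in C : clique_fun C \in edge_polys (n - #|C|).
Proof.
rewrite (_ : clique_fun C = [ffun e => esum e ^+ 0 * eprod e ^+ 0 *
    \prod_(z <- enum (~: C)) eval_at (z : nat)%:R e]).
  by apply: prod_eval_in; rewrite !addn0 -cardE (cardsCs (~: C)) setCK card_ord.
by apply/ffunP=> e; rewrite !ffunE !expr0 !mul1r.
Qed.

Lemma clique_fun_eq0 C (e : {set 'I_n}) : #|e| = 2 ->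
  (clique_fun C e == 0) = ~~ (e \subset C).
Proof.
move=> ce; rewrite ffunE prodf_seq_eq0; apply/hasP/subsetPn => -[z].
  by rewrite mem_enum inE /= eval_at_eq0 // => nCz ez; exists z.
by move=> ez nCz; exists z; rewrite ?mem_enum ?inE //= eval_at_eq0.
Qed.

(* The functions collected so far vanish on every missing pair, whereas the
   function of the new clique does not vanish on the pair just added. *)
Lemma clique_reach_free m (E E' : {set {set 'I_n}}) : clique_reach m E E' ->
  exists X : seq edge_fun,
  [/\ free X, {subset X <= edge_polys (n - m)},
      forall g (e : {set 'I_n}), g \in X -> #|e| = 2%N -> e \notin E' -> g e = 0 &
      (size X + #|E|)%N = #|E'|].
Proof.
elim=> [|{}E' e C _ [X [fX sX vX cX]] cC]; first by exists [::]; rewrite nil_free.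
rewrite inE => /andP[eC /eqP ce] sC.
have [eE|neE] := boolP (e \in E').
  have -> : e |: E' = E' by apply/setUidPr; rewrite sub1set.
  by exists X.
exists (clique_fun C :: X); split.
- rewrite free_cons fX andbT; apply/negP => /(@coord_span _ _ _ (in_tuple X)).
  move=> /(congr1 (fun g : edge_fun => g e)) /eqP.
  rewrite sum_ffunE big1 ?clique_fun_eq0 ?eC // => i _.
  by rewrite ffunE (vX _ e) ?scaler0 // mem_nth.
- by move=> g; rewrite inE => /predU1P[->|/sX//]; rewrite -cC clique_fun_in.
(* A pair still missing cannot lie in [C], because all pairs of [C] are now present. *)
- move=> g f; rewrite inE => /predU1P[-> cf nf|gX cf].
    apply/eqP; rewrite clique_fun_eq0 //; apply: contra nf => fC.
    by apply: (subsetP sC); rewrite inE fC cf eqxx.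
  by rewrite !inE negb_or => /andP[_ nf]; apply: vX.
- by rewrite cardsU1 neE /= -cX.
Qed.

End EdgeFunctions.

(** One independent function arises per pair gained, and their number cannot exceed the dimension of
    [edge_polys (n - m)]. *)
Theorem clique_reach_bound n m (E : {set {set 'I_n}}) :
  clique_reach m E (pairs setT) ->
  'C(n, 2) <= #|E| + 'C((n - m).+2, 2).
Proof.
move=> /clique_reach_free[X [fX sX _]].
rewrite card_pairs cardsT card_ord addnC => <-; rewrite leq_add2l.
apply: leq_trans (dim_edge_polys _ _); move: fX; rewrite /free => /eqP <-.
by apply/dimvS/span_subvP.
Qed.

(** * Pairs, their images, and adjacency in [F_graph] *)

Lemma pairsP (T : finType) (A : {set T}) (e : {set T}) :
  reflect (exists x y, [/\ x \in A, y \in A, x != y & e = [set x; y]])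
          (e \in pairs A).
Proof.
rewrite inE; apply: (iffP andP) => [[eA /cards2P[x [y [nxy Ee]]]]|].
  exists x, y; split=> //; apply: (subsetP eA); rewrite Ee !inE eqxx ?orbT //.
by move=> [x [y [Ax Ay nxy ->]]]; rewrite cards2 nxy subUset !sub1set Ax Ay.
Qed.

Lemma pairs_imset (T U : finType) (f : T -> U) (A : {set T}) (e : {set U}) :
  e \in pairs (f @: A) -> exists2 a, a \in pairs A & e = f @: a.
Proof.
case/pairsP=> [_ [_ [/imsetP[x Ax ->] /imsetP[y Ay ->] nxy ->]]].
exists [set x; y]; last by rewrite imsetU1 imset_set1.
by apply/pairsP; exists x, y; split=> //; apply: contraNneq nxy => ->.
Qed.

Lemma imset_pairs (T U : finType) (f : T -> U) (A : {set T}) (a : {set T}) :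
  injective f -> a \in pairs A -> f @: a \in pairs (f @: A).
Proof. by move=> injf; rewrite !inE card_imset // => /andP[aA ->]; rewrite imsetS. Qed.

Lemma edge_pairs (T : finType) (H : sgraph T) (e : {set T}) :
  e \in edges H -> e \in pairs setT.
Proof. by rewrite inE subsetT; have /forall_inP := edges_card2 H; apply. Qed.

Lemma complete_graphE (T : finType) : edges (complete_graph T) = pairs setT.
Proof. by apply/setP=> e; rewrite !inE subsetT. Qed.

Lemma F_edge v d (i j : 'I_v) : [set i; j] \in edges (F_graph v d) =
  [&& i != j, (i == 0 :> nat) ==> (j <= d) & (j == 0 :> nat) ==> (i <= d)].
Proof.
rewrite !inE cards2 eqSS eqb1 andbC; case: (eqVneq i j) => //= nij.
apply/idP/andP => [|[ij ji]]; last first.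
  apply/imset2P => -[x y]; rewrite !inE => /eqP x0 dy Eij.
  have := set21 i j; have := set22 i j; rewrite Eij !inE.
  case/orP=> /eqP Ej /orP[] /eqP Ei; subst i j; rewrite ?eqxx // in nij;
    by move: ij ji; rewrite x0 eqxx /= (leqNgt y) dy.
move=> nR; split; apply/implyP => i0; rewrite leqNgt; apply: contra nR => dj.
  by apply/imset2P; exists i j; rewrite ?inE.
by apply/imset2P; exists j i; rewrite ?inE // setUC.
Qed.

(** * Copies of [F_graph] and the cliques inside them *)

Section CopiesOfF.

Variables (v d : nat).
Hypotheses (d_gt0 : 0 < d) (d_lt : d.+1 < v).

Let F := F_graph v d.

(** The vertices 0, ..., d are the distinguished vertex and its neighbours, so no removed edge joins
    two of them. *)
Lemma F_star_clique (C : {set 'I_v}) :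
  C \subset [set x : 'I_v | x < d.+1] -> pairs C \subset edges F.
Proof.
move=> sC; apply/subsetP=> e /pairsP[x [y [Cx Cy nxy ->]]].
have := subsetP sC _ Cx; have := subsetP sC _ Cy; rewrite F_edge nxy !inE !ltnS.
by move=> -> ->; rewrite !implybT.
Qed.

(** Every removed edge is incident to vertex 0. *)
Lemma F_core_clique (C : {set 'I_v}) :
  C \subset [set x : 'I_v | 0 < x] -> pairs C \subset edges F.
Proof.
move=> sC; apply/subsetP=> e /pairsP[x [y [Cx Cy nxy ->]]].
have := subsetP sC _ Cx; have := subsetP sC _ Cy; rewrite F_edge nxy !inE.
by case: (x : nat) (y : nat) => [|?] [|?].
Qed.

Lemma card_core : #|[set x : 'I_v | 0 < x]| = v.-1.
Proof.
have v0 : 0 < v by lia.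
rewrite (_ : [set x : 'I_v | _] = ~: [set Ordinal v0]) ?cardsC1 ?card_ord //.
by apply/setP=> x; rewrite !inE -val_eqE lt0n.
Qed.

(** An edge avoiding vertex 0 extends inside the core, whose size [v.-1] is at least [d.+1]; an edge
    at vertex 0 lies in the clique on 0, ..., d. *)
Lemma F_edge_clique (a : {set 'I_v}) : a \in edges F ->
  exists C : {set 'I_v}, [/\ #|C| = d.+1, a \in pairs C & pairs C \subset edges F].
Proof.
move=> aF; have := edge_pairs aF; rewrite inE subsetT /= => ca.
case: (boolP (a \subset [set x : 'I_v | 0 < x])) => [sa|/subsetPn[x ax]].
  have [|C [aC CK] cC] := @ex_subset_between _ _ _ d.+1 sa.
    by rewrite (eqP ca) card_core; lia.
  by exists C; rewrite cC inE aC ca F_core_clique.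
rewrite inE -eqn0Ngt => x0; exists [set x : 'I_v | x < d.+1].
rewrite card_ord_lt 1?ltnW // inE ca andbT; split=> //; last exact: F_star_clique.
have /cards2P[y [z [_ Ea]]] := ca; rewrite Ea F_edge in aF.
move: ax aF; rewrite Ea subUset !sub1set !inE.
case/orP=> /eqP Ex; rewrite -Ex x0 (eqP x0) /= => /and3P[_].
  by rewrite !ltnS => ->.
by rewrite !ltnS => _ ->.
Qed.

Lemma in_copy_clique (T : finType) (H : sgraph T) (e : {set T}) :
  in_copy F H e ->
  exists C : {set T}, [/\ #|C| = d.+1, e \in pairs C & pairs C \subset edges H].
Proof.
case/existsP=> f /andP[/andP[/injectiveP injf /forall_inP fH]].
case/exists_inP=> a /F_edge_clique[C [cC aC CF]] /eqP ->.
exists (f @: C); rewrite card_imset // imset_pairs //; split=> //.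
by apply/subsetP=> _ /pairs_imset[b /(subsetP CF)/fH bH ->].
Qed.

(** The start [E] is left free, so that the clique process may begin below [H], with the redundant
    edges of a copy taken away. *)
Lemma connect_clique_reach (T : finType) (H H' : sgraph T) E :
  connect (bootstrap_step F) H H' ->
  clique_reach d.+1 E (edges H) -> clique_reach d.+1 E (edges H').
Proof.
case/connectP=> s; elim: s H => [|H1 s IHs] H /= => [_ -> //|/andP[HH1 sP] Es EH].
apply: IHs sP Es _; case/existsP: HH1 => e /and3P[_ /eqP EH1].
by case/in_copy_clique=> C [cC eC]; rewrite EH1; apply: clique_reach_add.
Qed.

(* With vertex 0 of degree d and core vertices 1, ..., v - 1, the pairs inside
   {d, ..., v - 1} can be recovered through the clique {1, ..., d - 1}, after
   which the pair {0, 1} is recovered through {0, ..., d}. *)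
Lemma copy_redundant (T : finType) (H : sgraph T) f : is_copy F H f ->
  exists2 E : {set {set T}}, clique_reach d.+1 E (edges H) &
    #|E| + ('C(v - d, 2)).+1 = #|edges H|.
Proof.
move=> /andP[/injectiveP injf /forall_inP fH].
have v0 : 0 < v by lia.
have v1 : 1 < v by lia.
pose e0 : {set 'I_v} := [set Ordinal v0; Ordinal v1].
(* Together with [D], of size [d.-1], any two vertices of [Y] form a set of the clique size
   [d.+1]. *)
pose D := [set x : 'I_v | 0 < x < d]; pose Y := [set x : 'I_v | d <= x].
pose R := pairs (f @: Y).
have cY : #|Y| = v - d.
  have -> : Y = ~: [set x : 'I_v | x < d].
    by apply/setP=> x; rewrite !inE -leqNgt.
  by rewrite cardsCs setCK card_ord card_ord_lt //; lia.
have cD : #|D| = d.-1.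
  have -> : D = [set x : 'I_v | x < d] :\ Ordinal v0.
    by apply/setP=> x; rewrite !inE -val_eqE lt0n.
  have := cardsD1 (Ordinal v0) [set x : 'I_v | x < d].
  by rewrite inE /= d_gt0 card_ord_lt; lia.
have e0F : pairs [set x : 'I_v | x < d.+1] \subset edges F by apply: F_star_clique.
have e0d : e0 \in pairs [set x : 'I_v | x < d.+1].
  by apply/pairsP; exists (Ordinal v0), (Ordinal v1); split; rewrite ?inE.
have fpairs A : pairs A \subset edges F -> pairs (f @: A) \subset edges H.
  by move=> AF; apply/subsetP=> _ /pairs_imset[b /(subsetP AF)/fH bH ->].
have RH : R \subset edges H.
  apply/fpairs/F_core_clique/subsetP=> x; rewrite !inE; exact: leq_trans.
(* Vertex 0 lies outside [Y] since [d] is positive, so [e0] is counted apart from [R] and supplies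
   the extra one. *)
have e0R : f @: e0 \notin R.
  apply: contraL d_gt0; rewrite inE => /andP[/subsetP/(_ (f (Ordinal v0)))].
  rewrite imset_f ?inE ?eqxx // => /(_ isT)/imsetP[x Yx /injf Ex] _.
  by move: Yx; rewrite -Ex inE leqn0 /= => /eqP->.
have e0H : f @: e0 \in edges H by apply/fH/(subsetP e0F).
exists (edges H :\: (f @: e0 |: R)); last first.
  have := cardsID (f @: e0 |: R) (edges H).
  rewrite (setIidPr _) ?subUset ?sub1set ?e0H // cardsU1 e0R card_pairs.
  by rewrite card_imset // cY => <-; rewrite addnC.
set E := _ :\: _.
have reachR : clique_reach d.+1 E (R :|: E).
  apply: clique_reach_addU; first exact: clique_reach_refl.
  move=> _ /pairs_imset[a aY ->]; exists (f @: (D :|: a)).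
  move: (aY); rewrite inE => /andP[saY /eqP ca].
  have disj : [disjoint D & a].
    rewrite disjoints_subset; apply/subsetP=> x; rewrite !inE => /andP[_].
    by rewrite ltnNge; apply: contra => /(subsetP saY); rewrite inE.
  split.
  - rewrite card_imset // cardsU (disjoint_setI0 disj) cards0 ca cD; lia.
  - by apply: imset_pairs => //; rewrite inE subsetUr ca.
  apply/subsetP=> _ /pairs_imset[b bD ->].
  have sDa : D :|: a \subset [set x : 'I_v | 0 < x].
    rewrite subUset; apply/andP; split; apply/subsetP=> x.
      by rewrite !inE => /andP[].
    by move/(subsetP saY); rewrite !inE; apply: leq_trans.
  have bF : b \in edges F by apply: (subsetP (F_core_clique sDa)).
  rewrite 4!inE (fH _ bF) andbT negb_or orbC; apply/orP.
  (* A pair of [D :|: a] other than [a] survives in [E]: it avoids vertex 0, so it is not [e0], and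
     it meets [D], so its image is not in [R]. *)
  have [-> | nba] := eqVneq b a; [by right; rewrite eqxx | left].
  rewrite inE in bD; case/andP: bD => sbD /eqP cb.
  apply/andP; split.
    rewrite inE; apply: contraTneq sbD => /(imset_inj injf) ->.
    apply/subsetPn; exists (Ordinal v0); first by rewrite !inE eqxx.
    by apply/negP => /(subsetP sDa); rewrite inE.
  apply: contra nba; rewrite inE => /andP[/subsetP sfb _].
  rewrite eqEcard cb ca leqnn andbT; apply/subsetP=> x bx.
  have /setUP[|//] := subsetP sbD _ bx.
  have /imsetP[y Yy /injf Exy] := sfb _ (imset_f f bx).
  by rewrite Exy in Yy *; move: Yy; rewrite !inE leqNgt => /negPf->; rewrite andbF.
have <- : f @: e0 |: (R :|: E) = edges H.
  apply/setP=> x; rewrite /E !(in_setU, in_setD, in_set1).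
  case: eqVneq => [->|_] /=; first by rewrite e0H.
  by case: (boolP (x \in R)) => [/(subsetP RH)->|].
apply: (clique_reach_add (C := f @: [set x : 'I_v | x < d.+1])) => //.
- by rewrite card_imset ?card_ord_lt // ltnW.
- exact: imset_pairs.
apply: subset_trans (fpairs _ e0F) _; apply/subsetP=> x xH.
rewrite /E !(in_setU, in_setD, in_set1) xH andbT.
by case: (x == _); case: (x \in R).
Qed.

Lemma complete_copy n : v <= n -> exists f, is_copy F (complete_graph 'I_n) f.
Proof.
move=> levn; exists [ffun x => widen_ord levn x].
have injf : injective [ffun x => widen_ord levn x].
  by move=> x y; rewrite !ffunE => /(congr1 val) /= /val_inj.
apply/andP; split; first exact/injectiveP.
by apply/forall_inP=> a /edge_pairs; rewrite !inE card_imset // => /andP[].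
Qed.

Lemma weakly_saturated_bound n (H : sgraph 'I_n) : v <= n ->
  weakly_saturated F H ->
  'C(n, 2) + 'C(v - d, 2) <= #|edges H| + 'C((n - d.+1).+2, 2).
Proof.
move=> levn satH.
(* The first step costs one edge, offset by the successor in [copy_redundant], and yields a copy. If
   the process is empty, [H] is complete and contains a copy because [v <= n]. *)
have [H1 [copyH1 satH1 cH1]] : exists H1 : sgraph 'I_n,
    [/\ exists f, is_copy F H1 f, weakly_saturated F H1 &
        #|edges H1| <= #|edges H|.+1].
  case/connectP: (satH) => -[|H1 s] /= => [_ <-|/andP[HH1 sP] Es].
    by exists (complete_graph 'I_n); split; rewrite ?leqnSn //;
      [exact: complete_copy | exact: connect0].
  exists H1; case/existsP: HH1 => e /and3P[neH /eqP ->].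
  case/existsP=> f /andP[cf _]; rewrite cardsU1 neH; split=> //; first by exists f.
  by apply/connectP; exists s.
have [f cf] := copyH1; have [E EH1 cE] := copy_redundant cf.
have := connect_clique_reach satH1 EH1.
by rewrite complete_graphE => /clique_reach_bound; lia.
Qed.

(** Vertex 0 of [F] goes to [w], its neighbours to [N], and the remaining core vertices to
    [K :\: N]. *)
Lemma star_in_copy (T : finType) (G : sgraph T) (K N : {set T}) w a :
  #|K| = v.-1 -> pairs K \subset edges G -> w \notin K -> N \subset K ->
  #|N| = d -> {in N, forall x, [set w; x] \in edges G} -> a \in N ->
  in_copy F G [set w; a].
Proof.
move=> cK KG wK NK cN NG aN.
have v0 : 0 < v by lia.
(* Listing [N] first puts it at positions 1, ..., d of [w :: s], matching the labels of the
   neighbours of vertex 0. *)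
pose s := enum N ++ enum (K :\: N).
have mem_s x : (x \in s) = (x \in K).
  rewrite mem_cat !mem_enum !inE; case: (boolP (x \in N)) => // /(subsetP NK).
  by move->.
have szN : size (enum N) = d by rewrite -cardE.
have szs : size s = v.-1.
  by rewrite size_cat -!cardE cardsD (setIidPr NK) cN cK; lia.
have us : uniq (w :: s).
  rewrite /= mem_s wK cat_uniq !enum_uniq /= andbT.
  by apply/hasPn => x; rewrite !mem_enum !inE => /andP[].
pose f : {ffun 'I_v -> T} := [ffun i : 'I_v => nth w (w :: s) i].
have injf : injective f.
  move=> i j; rewrite !ffunE => /eqP; rewrite nth_uniq //= ?szs ?prednK //.
  by move/eqP/val_inj.
have f0 (i : 'I_v) : i == 0 :> nat -> f i = w by rewrite ffunE => /eqP->.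
have fK (i : 'I_v) : i != 0 :> nat -> f i \in K.
  move=> i0; rewrite ffunE -mem_s -[_ i]prednK ?lt0n //= mem_nth // szs.
  by have := ltn_ord i; lia.
have fN (i : 'I_v) : i != 0 :> nat -> i <= d -> f i \in N.
  move=> i0 ilt; rewrite ffunE -[_ i]prednK ?lt0n //= nth_cat szN -mem_enum.
  have ltid : i.-1 < d by lia.
  by rewrite ltid mem_nth // szN.
apply/existsP; exists f; apply/andP; split.
  apply/andP; split; first exact/injectiveP.
  apply/forall_inP=> b bF.
  have /pairsP[i [j [_ _ nij Eb]]] := edge_pairs bF.
  move: bF; rewrite Eb F_edge nij /= imsetU1 imset_set1.
  have [i0|i0] := boolP (i == 0 :> nat); have [j0|j0] := boolP (j == 0 :> nat) => /=.
  - by case/eqP: nij; apply: val_inj; rewrite /= (eqP i0) (eqP j0).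
  - by rewrite andbT (f0 i) // => jd; apply/NG/fN.
  - by rewrite (f0 j) // setUC => id; apply/NG/fN.
  move=> _; apply: (subsetP KG); apply/pairsP; exists (f i), (f j).
  by rewrite !fK // (inj_eq injf).
have ltd : index a (enum N) < d by rewrite -szN index_mem mem_enum.
have ltv : (index a (enum N)).+1 < v by lia.
apply/exists_inP; exists [set Ordinal v0; Ordinal ltv].
  by rewrite F_edge /= ltd.
rewrite imsetU1 imset_set1 f0 // ffunE /= nth_cat index_mem mem_enum aN.
by rewrite nth_index ?mem_enum.
Qed.

End CopiesOfF.

(** * Upper bound: an explicit weakly saturated graph *)

(** Copies are demanded in every graph above [G] containing the new edge, so the missing edges can
    be added in any order. *)
Lemma connect_bootstrap (V T : finType) (F : sgraph V) (G G' : sgraph T) :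
  edges G \subset edges G' ->
  (forall (G1 : sgraph T) e, edges G \subset edges G1 -> e \in edges G1 ->
     e \in edges G' -> e \notin edges G -> in_copy F G1 e) ->
  connect (bootstrap_step F) G G'.
Proof.
have [m] := ubnP #|edges G' :\: edges G|.
elim: m => // m IHm in G' * => Em sGG' copyP.
have [E0|[e]] := set_0Vmem (edges G' :\: edges G).
  rewrite (_ : G' = G); first exact: connect0.
  by apply/val_inj/eqP; rewrite eqEsubset sGG' andbT -setD_eq0; apply/eqP.
rewrite inE => /andP[eG eG'].
(* The edge [e] is kept for the last step; the induction reaches [G'] without it. *)
have sub : edges G \subset edges (delete_edges G' [set e]).
  by rewrite subsetD sGG' disjoint_sym disjoints1.
apply: connect_trans (IHm _ _ sub _) (connect1 _).
  rewrite -ltnS; apply: leq_trans Em; rewrite ltnS; apply/proper_card.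
  rewrite properE.
  rewrite setSD ?subsetDl //=; apply/subsetPn; exists e; by rewrite !inE ?eG ?eqxx.
  by move=> G1 f sG fG1; rewrite inE => /andP[_ fG']; apply: copyP.
apply/existsP; exists e; rewrite !inE eqxx /= setD1K // eqxx /=.
exact: copyP.
Qed.

Section ExtremalGraph.

Variables (v d n : nat).
Hypotheses (d_gt0 : 0 < d) (d_lt : d.+1 < v) (le_vn : v <= n).

Let A m := [set x : 'I_n | x < m].

(** The graph of all pairs that lie in [E] or meet [S]; obtaining it by deletion makes the
    cardinality condition automatic. *)
Definition meeting_graph (S : {set 'I_n}) (E : {set {set 'I_n}}) : sgraph 'I_n :=
  delete_edges (complete_graph 'I_n)
    [set e : {set 'I_n} | (e \notin E) && [disjoint e & S]].

Lemma meeting_graphE S E e : (e \in edges (meeting_graph S E)) =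
  (#|e| == 2) && ((e \in E) || ~~ [disjoint e & S]).
Proof. by rewrite !inE andbC negb_and negbK. Qed.

Lemma in_meeting_graph (S : {set 'I_n}) E x (e : {set 'I_n}) :
  #|e| = 2 -> x \in e -> x \in S -> e \in edges (meeting_graph S E).
Proof.
move=> ce ex Sx; rewrite meeting_graphE ce eqxx /=; apply/orP; right.
by apply/pred0Pn; exists x; rewrite /= ex Sx.
Qed.

Definition extremal_graph := meeting_graph (A d.-1) (pairs (A v.-1)).

(** An inequality suffices, as the matching lower bound holds for every weakly saturated graph. *)
Lemma extremal_graph_card :
  #|edges extremal_graph| <= 'C(v.-1, 2) + (n - v.-1) * d.-1.
Proof.
pose P := [set [set p.1; p.2] | p in setX (~: A v.-1) (A d.-1)].
apply: (@leq_trans #|pairs (A v.-1) :|: P|); last first.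
  rewrite (leq_trans (leq_card_setU _ _)) // card_pairs card_ord_lt; last by lia.
  rewrite leq_add2l (leq_trans (leq_imset_card _ _)) //.
  by rewrite cardsX cardsCs setCK card_ord !card_ord_lt //; lia.
apply/subset_leq_card/subsetP=> e; rewrite meeting_graphE in_setU.
case/andP=> ce /orP[-> //|]; case/pred0Pn=> x /= /andP[ex].
rewrite inE => xd; have [//|] := boolP (e \in pairs _).
rewrite inE ce andbT => /subsetPn[y ye yv]; apply/imsetP; exists (y, x).
  by rewrite in_setX in_setC yv inE.
apply/eqP; rewrite eq_sym eqEcard subUset !sub1set ye ex (eqP ce) cards2.
by rewrite (contraNneq _ yv) // => /= ->; rewrite inE; lia.
Qed.

(** Two phases meet at [G1]: first every outside vertex is joined to the whole clique on [A v.-1],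
    then the outside vertices are joined to each other. *)
Lemma extremal_graph_saturated :
  weakly_saturated (F_graph v d) extremal_graph.
Proof.
pose G1 := meeting_graph (A v.-1) set0.
have A_le m k : m <= k -> A m \subset A k.
  by move=> lemk; apply/subsetP=> x; rewrite !inE => /leq_trans; apply.
have cardA m : m <= n -> #|A m| = m by apply: card_ord_lt.
have pair_eq (e : {set 'I_n}) x y : #|e| = 2 -> x \in e -> y \in e -> x != y ->
    e = [set x; y].
  move=> ce ex ey nxy; apply/esym/eqP.
  by rewrite eqEcard subUset !sub1set ex ey ce cards2 nxy.
apply: (@connect_trans _ _ G1); apply: connect_bootstrap.
- apply/subsetP=> e; rewrite meeting_graphE => /andP[/eqP ce].
  case/orP=> [/pairsP[x [y [Ax _ _ Ee]]]|/pred0Pn[x /andP[ex Ax]]].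
    by apply: (in_meeting_graph _ _ _ Ax) => //; rewrite Ee set21.
  by apply: (in_meeting_graph _ _ ex) => //; apply: subsetP Ax; apply: A_le; lia.
- move=> G e sG eG; rewrite !meeting_graphE inE /= => /andP[/eqP ce].
  case/pred0Pn=> x /andP[/= ex Ax].
  rewrite ce eqxx /= negb_or negbK inE ce andbT => /andP[/subsetPn[w ew Aw] dis].
  have nwx : w != x by apply: contraNneq Aw => ->.
  have Dx : x \notin A d.-1.
    by apply: contraL dis => Dx; apply/pred0Pn; exists x; rewrite /= ex.
  have Ee := pair_eq _ _ _ ce ew ex nwx; rewrite Ee.
  have DA : A d.-1 \subset A v.-1 by apply: A_le; lia.
  (* The vertex [w] already sees the [d.-1] vertices of [A d.-1]; the new neighbour [x] is the
     [d]-th. *)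
  apply: (@star_in_copy _ _ _ _ _ _ (A v.-1) (x |: A d.-1)) => //.
  + by rewrite cardA; lia.
  + apply: subset_trans sG; apply/subsetP=> f fA; rewrite meeting_graphE fA.
    by move: fA; rewrite inE => /andP[_ ->].
  + by rewrite subUset sub1set Ax.
  + by rewrite cardsU1 Dx cardA; lia.
  + move=> y /setU1P[->|Dy]; first by rewrite -Ee.
    apply: (subsetP sG); apply: (in_meeting_graph _ _ _ Dy); last exact: set22.
    by rewrite cards2 (contraNneq _ Aw) // => ->; apply: (subsetP DA).
  + exact: setU11.
- by rewrite complete_graphE; apply/subsetP=> e /edge_pairs.
move=> G e sG eG; rewrite complete_graphE => /pairsP[u [w [_ _ nuw Ee]]].
have ce : #|e| = 2 by rewrite Ee cards2 nuw.
rewrite meeting_graphE ce eqxx inE /= negbK => dis.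
have notA x m : x \in e -> m <= v.-1 -> x \notin A m.
  move=> ex lem; apply: contraL dis => /(subsetP (A_le _ _ lem)) Ax.
  by apply/pred0Pn; exists x; rewrite /= ex.
have eu : u \in e by rewrite Ee set21.
have ew : w \in e by rewrite Ee set22.
have AA : A v.-2 \subset A v.-1 by apply: A_le; lia.
have DA : A d.-1 \subset A v.-2 by apply: A_le; lia.
have inG1 x y : x != y -> y \in A v.-2 -> [set x; y] \in edges G.
  move=> nxy Ay; apply: (subsetP sG).
  apply: (in_meeting_graph _ _ (set22 x y)); first by rewrite cards2 nxy.
  exact: (subsetP AA).
rewrite Ee setUC.
(* Here [u] takes the place of one core vertex: it is adjacent in [G1] to all of [A v.-2], and it
   becomes the [d]-th neighbour of [w]. *)
apply: (@star_in_copy _ _ _ _ _ _ (u |: A v.-2) (u |: A d.-1)) => //.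
- by rewrite cardsU1 notA ?cardA //; lia.
- apply/subsetP=> f /pairsP[x [y [Kx Ky nxy ->]]].
  case/setU1P: Ky => [Ey|Ay]; last exact: inG1.
  case/setU1P: Kx => [Ex|Ax]; first by rewrite Ex Ey eqxx in nxy.
  by rewrite setUC inG1 // eq_sym.
- by rewrite in_setU1 negb_or eq_sym nuw notA //; lia.
- by rewrite setUS.
- by rewrite cardsU1 notA ?cardA //; lia.
- move=> y /setU1P[->|Dy]; first by rewrite setUC -Ee.
  have Ay := subsetP DA _ Dy; apply: inG1 => //.
  by apply: contraTneq Ay => <-; apply: notA => //; lia.
- exact: setU11.
Qed.

End ExtremalGraph.

(** * Binomial identities and the final count *)

(** Pairs in a disjoint union lie in one part or cross between the two. *)
Lemma bin2_addn m k : 'C(m + k, 2) = 'C(m, 2) + m * k + 'C(k, 2).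
Proof.
elim: k => [|k IHk]; first by rewrite addn0 muln0 !addn0.
by rewrite addnS !binS !bin1 IHk; lia.
Qed.

Lemma saturation_count v d n : 0 < d -> d < v -> v <= n ->
  'C(v - 1, 2) + (n - v + 1) * (d - 1) + 'C((n - d.+1).+2, 2) =
  'C(n, 2) + 'C(v - d, 2).
Proof.
move=> d_gt0 lt_dv le_vn.
(* The parameters t = v - d, a = n - v + 1 and c = d - 1 remove every truncated subtraction before
   the binomials are expanded. *)
have [t Ev] : exists t, v = d + t by exists (v - d); lia.
have [a En] : exists a, n = v.-1 + a by exists (n - v.-1); lia.
have [c Ed] : exists c, d = c.+1 by exists d.-1; lia.
have -> : v - d = t by lia.
have -> : (n - d.+1).+2 = t + a by lia.
have -> : v - 1 = t + c by lia.
have -> : n - v + 1 = a by lia.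
have -> : d - 1 = c by lia.
have -> : n = t + (c + a) by lia.
by rewrite !bin2_addn; lia.
Qed.

Theorem theorem5p1 (v d n : nat) (hv : 3 <= v) (hd1 : 1 <= d)
    (hd2 : d <= v - 2) (hn : v <= n) :
  wsat n (F_graph v d) = 'C(v - 1, 2) + (n - v + 1) * (d - 1).
Proof.
have ltdv : d.+1 < v by lia.
have [[H satH cH] minH] := (wsatP n (F_graph v d) _).1 erefl.
apply/eqP; rewrite eqn_leq; apply/andP; split.
  apply: leq_trans (minH _ (extremal_graph_saturated hd1 ltdv hn)) _.
  apply: leq_trans (extremal_graph_card hd1 ltdv hn) _.
  by rewrite !subn1 (_ : n - v.-1 = n - v + 1) //; lia.
(* The bound and the count share the term C(n - d + 1, 2), which cancels. *)
have := weakly_saturated_bound hd1 ltdv hn satH; rewrite -cH.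
have := saturation_count hd1 (ltnW ltdv) hn; lia.
Qed.
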